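(* Let $\Sigma\subset\mathbb R^n$ be a hyperplane separating $\mathbb R^n$ into open half-spaces $U^\pm$, with unit normal $\mathbf n$ pointing from $U^-$ to $U^+$; let $u^\pm\in U^\pm$, let $Q^\pm$ be real symmetric invertible $n\times n$ matrices, and let $f(u)=Q^\pm(u-u^\pm)$ for $u\in U^\pm$. Let $\gamma$ be a heteroclinic trajectory of $u'=f(u)$ from $u^-$ to $u^+$ with $\gamma(\xi)\in U^\pm$ for $\pm\xi>0$, $\gamma(0)=w\in\Sigma$, and $\langle\hat f^\pm,\mathbf n\rangle>0$, where $\hat f^\pm=Q^\pm(w-u^\pm)$. Then a number $\lambda\neq0$ with $\operatorname{Re}\lambda\ge0$ is an eigenvalue of the spectral problem associated with $\gamma$ if and only if $$D(\lambda)=\det\big(P^+(\lambda)-SP^-(\lambda)\big)=0.$$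
   Context: Here $Sv=v+(\hat f^+-\hat f^-)\dfrac{\langle v,\mathbf n\rangle}{\langle\hat f^-,\mathbf n\rangle}$. Spectral problem: $\lambda\in\mathbb C$ is an eigenvalue if there is a not identically zero pair $(v,z)$ with values in $\mathbb C^n\times\mathbb C^n$, smooth on $(-\infty,0]$ and on $[0,\infty)$ (with one-sided limits at $0$), such that $v'=Q^\pm v+z$, $z'=\lambda v$ for $\pm\xi>0$, $v(+0)=Sv(-0)$, $z(+0)=z(-0)$, and $v,z\to0$ as $\xi\to\pm\infty$. Matrices $P^\pm(\lambda)$: for $\operatorname{Re}\lambda\ge0$, $\lambda\ne0$, $P^\pm(\lambda)$ is the unique matrix satisfying $(P^\pm)^2-P^\pm Q^\pm-\lambda I=0$ all of whose eigenvalues $\sigma$ satisfy $\mp\operatorname{Re}\sigma>0$. Explicitly, if $Q^\pm=T_\pm^{-1}\operatorname{diag}(h_1^\pm,\dots,h_n^\pm)T_\pm$ with $T_\pm\in SO(n)$, then $P^\pm=T_\pm^{-1}\operatorname{diag}(\sigma_1^\pm,\dots,\sigma_n^\pm)T_\pm$, $\sigma_j^\pm=\frac12\big(h_j^\pm\mp\sqrt{(h_j^\pm)^2+4\lambda}\big)$, with the branch $\operatorname{Re}\sqrt{\cdot}>0$. *)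

(* Defs.v *)
From HB Require Import structures.
From mathcomp Require Import all_boot all_order all_algebra.
From mathcomp Require Import all_classical all_reals all_analysis.
From mathcomp Require Import complex.

Set Implicit Arguments.
Unset Strict Implicit.
Unset Printing Implicit Defensive.

Import Order.TTheory GRing.Theory Num.Theory numFieldNormedType.Exports.

Local Open Scope classical_set_scope.
Local Open Scope ring_scope.
Local Open Scope complex_scope.

(* Bilinear (not sesquilinear) in the complex case; it is only applied there
   with a real vector as second argument. *)
Definition dot (K : comNzRingType) (n : nat) (u v : 'cV[K]_n) : K :=
  \sum_i u i 0 * v i 0.

Definition toC (R : realType) (m n : nat) (A : 'M[R]_(m, n)) : 'M[R[i]]_(m, n) :=
  map_mx (fun x : R => x%:C) A.

(* A C^n-valued function is handled through its real and imaginary parts, so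
   that limits and derivatives are those of the real normed space R^n. *)
Section ComplexVectorFunctions.
Context {R : realType} {n : nat}.
Implicit Types v : R -> 'cV[R[i]]_n.

Definition RePart v : R -> 'cV[R]_n := fun x => map_mx (@complex.Re R) (v x).
Definition ImPart v : R -> 'cV[R]_n := fun x => map_mx (@complex.Im R) (v x).

Definition cvgC v (F : set_system R) (l : 'cV[R[i]]_n) : Prop :=
  RePart v @ F --> map_mx (@complex.Re R) l /\
  ImPart v @ F --> map_mx (@complex.Im R) l.

Definition is_deriveC (x : R) v (d : 'cV[R[i]]_n) : Prop :=
  is_derive x (1 : R) (RePart v) (map_mx (@complex.Re R) d) /\
  is_derive x (1 : R) (ImPart v) (map_mx (@complex.Im R) d).

(* Smoothness on [0, +oo[, resp. on ]-oo, 0]: C^oo on the open half-line, each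
   derivative having a one-sided limit at 0.  The value at 0 plays no role. *)
Definition smooth_pos (g : R -> 'cV[R]_n) : Prop :=
  forall k : nat,
    (forall x : R, 0 < x -> derivable (derive1n k g) x (1 : R)) /\
    cvg (derive1n k g x @[x --> (0 : R)^'+]).

Definition smooth_neg (g : R -> 'cV[R]_n) : Prop :=
  forall k : nat,
    (forall x : R, x < 0 -> derivable (derive1n k g) x (1 : R)) /\
    cvg (derive1n k g x @[x --> (0 : R)^'-]).

Definition smooth_halflines v : Prop :=
  [/\ smooth_pos (RePart v), smooth_pos (ImPart v),
      smooth_neg (RePart v) & smooth_neg (ImPart v)].

End ComplexVectorFunctions.

(* Matrix of S : v |-> v + (fp - fm) <v, nn> / <fm, nn>; see [saltationE]. *)
Definition saltation (R : realType) (n : nat) (nn fp fm : 'cV[R]_n) : 'M[R]_n :=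
  1%:M + (dot fm nn)^-1 *: ((fp - fm) *m nn^T).

Lemma saltationE (R : realType) (n : nat) (nn fp fm : 'cV[R]_n)
    (v : 'cV[R[i]]_n) :
  toC (saltation nn fp fm) *m v =
  v + (dot v (toC nn) / dot (toC fm) (toC nn)) *: (toC fp - toC fm).
Proof.
have dotC : dot (toC fm) (toC nn) = (dot fm nn)%:C.
  by rewrite /dot rmorph_sum; apply: eq_bigr => i _; rewrite !mxE rmorphM.
rewrite /saltation /toC map_mxD map_mx1 map_mxZ map_mxM map_mxB -matrix.map_trmx.
rewrite mulmxDl mul1mx -scalemxAl -mulmxA -/(toC fm) -/(toC nn) -/(toC fp) dotC.
have -> : (toC nn)^T *m v = (dot v (toC nn))%:M.
  apply/matrixP => i j; rewrite !ord1 !mxE; apply: eq_bigr => k _.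
  by rewrite !mxE mulrC.
by rewrite mul_mx_scalar scalerA mulrC fmorphV.
Qed.

(* Solutions live on R \ {0}: the value at 0 of [v] and [z] is irrelevant, hence
   the exclusion of 0 in the nontriviality clause; [v0], [z0] are v(-0), z(-0). *)
Definition spectral_eigenvalue (R : realType) (n : nat) (Qp Qm S : 'M[R]_n)
    (lambda : R[i]) : Prop :=
  exists v z : R -> 'cV[R[i]]_n,
  [/\ exists2 x : R, x != 0 & (v x != 0) || (z x != 0),
      smooth_halflines v /\ smooth_halflines z,
      (forall x : R, 0 < x ->
         is_deriveC x v (toC Qp *m v x + z x) /\
         is_deriveC x z (lambda *: v x)) /\
      (forall x : R, x < 0 ->
         is_deriveC x v (toC Qm *m v x + z x) /\
         is_deriveC x z (lambda *: v x)),
      (exists v0 z0 : 'cV[R[i]]_n,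
         [/\ cvgC v (0 : R)^'- v0, cvgC v (0 : R)^'+ (toC S *m v0),
             cvgC z (0 : R)^'- z0 & cvgC z (0 : R)^'+ z0]) &
      [/\ cvgC v +oo%R 0, cvgC z +oo%R 0, cvgC v -oo%R 0 & cvgC z -oo%R 0]].

Definition is_Pplus (R : realType) (n : nat) (Q : 'M[R]_n) (lambda : R[i])
    (P : 'M[R[i]]_n) : Prop :=
  P *m P - P *m toC Q - lambda%:M = 0 /\
  (forall sigma : R[i], eigenvalue P sigma -> complex.Re sigma < 0).

Definition is_Pminus (R : realType) (n : nat) (Q : 'M[R]_n) (lambda : R[i])
    (P : 'M[R[i]]_n) : Prop :=
  P *m P - P *m toC Q - lambda%:M = 0 /\
  (forall sigma : R[i], eigenvalue P sigma -> 0 < complex.Re sigma).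

(* For Q symmetric, Re lambda >= 0 and lambda != 0, exactly one matrix satisfies
   [is_Pplus Q lambda] and exactly one satisfies [is_Pminus Q lambda]; [xget]
   selects it, the default 0 being used only outside this range. *)
Definition Pplus (R : realType) (n : nat) (Q : 'M[R]_n) (lambda : R[i]) :
  'M[R[i]]_n := xget 0 [set P | is_Pplus Q lambda P].

Definition Pminus (R : realType) (n : nat) (Q : 'M[R]_n) (lambda : R[i]) :
  'M[R[i]]_n := xget 0 [set P | is_Pminus Q lambda P].

Definition Dfun (R : realType) (n : nat) (Qp Qm S : 'M[R]_n) (lambda : R[i]) :
  R[i] := \det (Pplus Qp lambda - toC S *m Pminus Qm lambda).

Definition half_plus (R : realType) (n : nat) (nn : 'cV[R]_n) (c : R) :
  set 'cV[R]_n := [set u | c < dot u nn].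

Definition half_minus (R : realType) (n : nat) (nn : 'cV[R]_n) (c : R) :
  set 'cV[R]_n := [set u | dot u nn < c].

Definition hyperplane (R : realType) (n : nat) (nn : 'cV[R]_n) (c : R) :
  set 'cV[R]_n := [set u | dot u nn = c].

(* Trajectory of u' = f(u) for a field [f] that may jump across (and whose
   values do not matter on) the set [Sigma]. *)
Definition trajectory (R : realType) (n : nat) (Sigma : set 'cV[R]_n)
    (f : 'cV[R]_n -> 'cV[R]_n) (gamma : R -> 'cV[R]_n) : Prop :=
  continuous gamma /\
  (forall x : R, ~ Sigma (gamma x) -> is_derive x (1 : R) gamma (f (gamma x))).

Definition heteroclinic (R : realType) (n : nat) (Sigma : set 'cV[R]_n)
    (f : 'cV[R]_n -> 'cV[R]_n) (um up : 'cV[R]_n) (gamma : R -> 'cV[R]_n) : Prop :=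
  [/\ trajectory Sigma f gamma,
      gamma x @[x --> -oo%R] --> um & gamma x @[x --> +oo%R] --> up].

(* Main.v *)
(* Since Q is real symmetric, a complex invertible U diagonalises it.  Along an
   eigenvector with eigenvalue h the system v' = h v + z, z' = lambda v has the
   characteristic roots s, t with s + t = h, s t = - lambda, whose real parts have
   opposite strict signs; P is the matrix with eigenvalues s on the same
   eigenvectors, s being the root that decays on the half-line considered.
   The combination a = lambda v - P z solves a' = t a componentwise, so |a|^2 is
   monotone and can only tend to 0 at infinity by vanishing identically.  Hence
   the decaying solutions are exactly those with z' = P z and lambda v = P z, and
   matching at 0 becomes (P^+ - S P^-) z(0) = 0, with z(0) = 0 only for the zero
   solution, by the same monotonicity argument run towards 0. *)
Require Import Defs.
From HB Require Import structures.
From mathcomp Require Import all_boot all_order all_algebra.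
From mathcomp Require Import all_classical all_reals all_analysis.
From mathcomp Require Import complex.
From mathcomp Require Import spectral ring lra.

Set Implicit Arguments.
Unset Strict Implicit.
Unset Printing Implicit Defensive.

Import Order.TTheory GRing.Theory Num.Theory numFieldNormedType.Exports.

Local Open Scope classical_set_scope.
Local Open Scope ring_scope.
Local Open Scope complex_scope.

(** * The matrices P^+ and P^- *)

(** A real symmetric matrix is Hermitian over [R[i]], so the spectral theorem applies and the
    eigenvalues are real. The rows of [U] are left eigenvectors; later arguments therefore multiply
    by [U] on the left. *)
Lemma toC_sym_diagonalizable (R : realType) (n : nat) (Q : 'M[R]_n) :
  Q^T = Q ->
  exists2 U : 'M[R[i]]_n, U \in unitmx &
  exists h : 'rV[R]_n, U *m toC Q = diag_mx (toC h) *m U.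
Proof.
move=> Qsym.
have Qreal : toC Q \is a realmx.
  by apply/mxOverP => i j; rewrite mxE complex_real.
have Qherm : toC Q \is hermsymmx.
  apply: realsym_hermsym => //.
  by apply/is_hermitianmxP; rewrite expr0 scale1r map_mx_id//; apply/matrixP => i j; rewrite !mxE -{1}Qsym mxE.
have /orthomx_spectralP QE := hermitian_normalmx Qherm.
exists (spectralmx (toC Q)); first exact: spectral_unit.
exists (map_mx (@complex.Re R) (spectral_diag (toC Q))).
rewrite {2}QE !mulmxA mulmxV ?spectral_unit// mul1mx; congr (diag_mx _ *m _).
apply/matrixP => i j; rewrite !mxE RRe_real//.
exact: (mxOverP (hermitian_spectral_diag_real Qherm)).
Qed.

(** These are the roots of X^2 - h X - lambda. Their sum is real, so s = a + ib and t = c - ib, and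
    Re(st) = ac + b^2 = - Re lambda <= 0 gives ac <= 0. If ac = 0, then b = 0 and Re lambda = 0,
    whence Im(st) = b(c - a) = 0 and lambda = 0. *)
Lemma dichotomy_roots (R : realType) (h : R) (lambda : R[i]) :
  lambda != 0 -> 0 <= complex.Re lambda ->
  exists st : R[i] * R[i], [/\ st.1 + st.2 = h%:C, st.1 * st.2 = - lambda,
    complex.Re st.1 < 0 & 0 < complex.Re st.2].
Proof.
move=> l0 lRe.
pose r := sqrtC (h%:C ^+ 2 + 4%:R * lambda).
have rr : r ^+ 2 = h%:C ^+ 2 + 4%:R * lambda by rewrite sqrtCK.
pose s := (h%:C - r) / 2%:R; pose t := (h%:C + r) / 2%:R.
have st : s + t = h%:C by rewrite /s /t; field.
have st' : s * t = - lambda.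
  rewrite /s /t; transitivity ((h%:C ^+ 2 - r ^+ 2) / 4%:R); first by field.
  by rewrite rr; field.
have prod : complex.Re s * complex.Re t < 0.
  case: s t st st' => [a b] [c d] /= /eqP; rewrite eq_complex /= => /andP[_ /eqP bd].
  case: lambda l0 lRe {r rr} => [p q] l0 /= p0 /eqP; rewrite eq_complex /= => /andP[/eqP e1 /eqP e2].
  have db : d = - b by lra.
  subst d.
  rewrite lt_neqAle; apply/andP; split; last by nra.
  apply: contra_neq l0 => ac.
  have p00 : p = 0 by nra.
  have b0 : b = 0 by nra.
  by apply/eqP; rewrite eq_complex /= p00 eqxx /=; apply/eqP; rewrite b0 in e2; lra.
(* The branch picked by [sqrtC] does not tell which root has negative real part, so the pair is
   swapped when needed. *)
have [s0|s0] := ltP (complex.Re s) 0.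
  by exists (s, t); split => //=; rewrite -(nmulr_rlt0 _ s0).
have s1 : 0 < complex.Re s.
  by rewrite lt_neqAle s0 andbT; apply: contraTneq prod => <-; rewrite mul0r ltxx.
by exists (t, s); split; rewrite //= 1?addrC 1?mulrC// -(pmulr_rlt0 _ s1).
Qed.

(* Writing the equation as P (P - Q) = lambda exhibits P - Q as a multiple of
   the inverse of P, so P commutes with Q. *)
Lemma quadratic_solution_comm (F : fieldType) (n : nat) (P Q : 'M[F]_n) (l : F) :
  l != 0 -> P *m P - P *m Q - l%:M = 0 -> Q *m P = P *m Q.
Proof.
move=> l0 /eqP; rewrite subr_eq0 -mulmxBr => /eqP PPQ.
have /mulmx1C : P *m (l^-1 *: (P - Q)) = 1%:M.
  by rewrite -scalemxAr PPQ scale_scalar_mx mulVf.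
rewrite -scalemxAl => /(congr1 ( *:%R l)).
rewrite scalerA mulfV// scale1r scalemx1 -PPQ mulmxBl mulmxBr.
by move/addrI/oppr_inj.
Qed.

(* A left eigenvector u of Q satisfies u (P - s) (P - t) = 0, where P - t is
   invertible. *)
Lemma quadratic_solution_diag (F : fieldType) (n : nat) (P Q U : 'M[F]_n)
    (s t : 'rV[F]_n) (l : F) :
  l != 0 -> U *m Q = diag_mx (s + t) *m U -> (forall j, s 0 j * t 0 j = - l) ->
  P *m P - P *m Q - l%:M = 0 -> (forall j, ~~ eigenvalue P (t 0 j)) ->
  U *m P = diag_mx s *m U.
Proof.
move=> l0 UQ st PQ nev; apply/row_matrixP => j.
rewrite !row_mul row_diag_mx -scalemxAl -rowE; set u := row j U.
have uQ : u *m Q = (s 0 j + t 0 j) *: u.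
  by rewrite /u -row_mul UQ row_mul row_diag_mx -scalemxAl -rowE mxE.
have uPP : u *m P *m P = (s 0 j + t 0 j) *: (u *m P) + l *: u.
  have /(congr1 (mulmx u)) := PQ.
  rewrite mulmx0 2!mulmxBr mul_mx_scalar => /eqP; rewrite -addrA -opprD subr_eq0.
  rewrite -(quadratic_solution_comm l0 PQ) !mulmxA uQ -scalemxAl.
  by move/eqP.
apply/eqP; rewrite -subr_eq0; apply: contraNT (nev j) => w0.
apply/eigenvalueP; exists (u *m P - s 0 j *: u) => //.
rewrite mulmxBl uPP -scalemxAl scalerBr scalerA mulrC st scaleNr opprK scalerDl.
by rewrite -[X in X - _]addrA addrC addrK.
Qed.

Lemma eigenvalue_diag (F : fieldType) (n : nat) (P U : 'M[F]_n)
    (s : 'rV[F]_n) (a : F) :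
  U \in unitmx -> U *m P = diag_mx s *m U -> eigenvalue P a ->
  exists j, a = s 0 j.
Proof.
move=> Uu UP /eigenvalueP[u uP u0].
have [w uE] : exists w, u = w *m U by exists (u *m invmx U); rewrite mulmxKV.
have w0 : w != 0 by apply: contraNneq u0 => w0; rewrite uE w0 mul0mx.
have [j wj] : exists j, w 0 j != 0.
  by apply/rV0Pn.
exists j; have : w *m diag_mx s = a *: w.
  by apply: (can_inj (mulmxK Uu)); rewrite -mulmxA -UP mulmxA -uE uP -scalemxAl -uE.
by move/rowP/(_ j); rewrite mul_mx_diag !mxE => wsj; apply: (mulIf wj); rewrite -wsj mulrC.
Qed.

(** In the basis given by [U] the quadratic equation splits into the scalar equations s^2 - s(s + t)
    - l = 0, which hold because s t = - l. *)
Lemma quadratic_solution_ex (F : fieldType) (n : nat) (Q U : 'M[F]_n)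
    (s t : 'rV[F]_n) (l : F) :
  U \in unitmx -> U *m Q = diag_mx (s + t) *m U ->
  (forall j, s 0 j * t 0 j = - l) ->
  exists2 P : 'M[F]_n, P *m P - P *m Q - l%:M = 0 & U *m P = diag_mx s *m U.
Proof.
move=> Uu UQ st; pose P := invmx U *m diag_mx s *m U.
have UP : U *m P = diag_mx s *m U by rewrite /P -!mulmxA mulKVmx.
exists P => //; apply: (can_inj (mulKmx Uu)); rewrite mulmx0.
have UPP : U *m (P *m P) = diag_mx s *m diag_mx s *m U.
  by rewrite mulmxA UP -mulmxA UP mulmxA.
have UPQ : U *m (P *m Q) = diag_mx s *m diag_mx (s + t) *m U.
  by rewrite mulmxA UP -mulmxA UQ mulmxA.
rewrite !mulmxBr UPP UPQ mul_mx_scalar -mul_scalar_mx -!mulmxBl.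
suff -> : diag_mx s *m diag_mx s - diag_mx s *m diag_mx (s + t) - l%:M = 0.
  by rewrite mul0mx.
rewrite !mulmx_diag; apply/matrixP => i j; rewrite !mxE.
have [->|_] := eqVneq i j; last by rewrite !mulr0n !subr0.
by rewrite !mulr1n mulrDr st opprD opprK addrA subrr add0r subrr.
Qed.

(** A single [U] diagonalises Q, P^+ and P^-. Existence of a solution makes [xget] return a matrix
    with the defining property. The sign condition on its spectrum excludes the other family of
    roots as eigenvalues, which is what [quadratic_solution_diag] requires to identify it. *)
Lemma Pplus_Pminus_diag (R : realType) (n : nat) (Q : 'M[R]_n) (lambda : R[i]) :
  Q^T = Q -> lambda != 0 -> 0 <= complex.Re lambda ->
  exists2 U : 'M[R[i]]_n, U \in unitmx &
  exists st : 'rV[R[i]]_n * 'rV[R[i]]_n,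
  [/\ U *m toC Q = diag_mx (st.1 + st.2) *m U,
      forall j, st.1 0 j * st.2 0 j = - lambda,
      forall j, complex.Re (st.1 0 j) < 0 /\ 0 < complex.Re (st.2 0 j),
      U *m Pplus Q lambda = diag_mx st.1 *m U &
      U *m Pminus Q lambda = diag_mx st.2 *m U].
Proof.
move=> Qsym l0 lRe; have [U Uu [h UQ]] := toC_sym_diagonalizable Qsym.
have /choice[st stP] := fun j : 'I_n => dichotomy_roots (h 0 j) l0 lRe.
pose s := \row_j (st j).1; pose t := \row_j (st j).2.
have hE : toC h = s + t.
  by apply/rowP => j; rewrite !mxE; have [-> _ _ _] := stP j.
rewrite hE in UQ.
have stl j : s 0 j * t 0 j = - lambda by rewrite !mxE; have [] := stP j.
have st0 j : complex.Re (s 0 j) < 0 /\ 0 < complex.Re (t 0 j).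
  by rewrite !mxE; have [] := stP j.
have UQ' : U *m toC Q = diag_mx (t + s) *m U by rewrite addrC.
have tsl j : t 0 j * s 0 j = - lambda by rewrite mulrC.
exists U => //; exists (s, t); split => //=.
- have [P PQ UP] := quadratic_solution_ex Uu UQ stl.
  have : is_Pplus Q lambda (Pplus Q lambda).
    apply: (xgetPex 0); exists P; split => // a /(eigenvalue_diag Uu UP)[j ->].
    exact: (st0 j).1.
  case=> PQ' ev; apply: (quadratic_solution_diag l0 UQ stl PQ') => j.
  by apply/negP => /ev; rewrite ltNge ltW// (st0 j).2.
- have [P PQ UP] := quadratic_solution_ex Uu UQ' tsl.
  have : is_Pminus Q lambda (Pminus Q lambda).
    apply: (xgetPex 0); exists P; split => // a /(eigenvalue_diag Uu UP)[j ->].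
    exact: (st0 j).2.
  case=> PQ' ev; apply: (quadratic_solution_diag l0 UQ' tsl PQ') => j.
  by apply/negP => /ev; rewrite ltNge ltW// (st0 j).1.
Qed.

(** * Limits and derivatives of complex vector functions *)

Lemma cvg_mxP (R : realType) (T : Type) (m n : nat) (F : set_system T)
    (f : T -> 'M[R]_(m, n)) (l : 'M[R]_(m, n)) : Filter F ->
  f @ F --> l <-> forall i j, f x i j @[x --> F] --> l i j.
Proof.
move=> FF; split=> [fl i j|fl].
  exact: (cvg_comp _ _ fl (@coord_continuous _ _ _ i j l)).
apply/cvgrPdist_le => e e0; near=> x.
rewrite /Num.Def.normr/= mx_normrE (bigmax_le _ (ltW e0))//= => i _.
rewrite !mxE/=.
move: i; near: x; apply: filter_forall => /= i.
exact: ((cvgrPdist_le _ _).1 (fl i.1 i.2)).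
Unshelve. all: by end_near. Qed.

Lemma is_derive_mxP (R : realType) (m n : nat) (f : R -> 'M[R]_(m, n)) (x : R)
    (d : 'M[R]_(m, n)) :
  is_derive x 1 f d <-> forall i j, is_derive x 1 (fun t => f t i j) (d i j).
Proof.
split=> [[fx <-] i j|fd].
  rewrite derive_mx// mxE; apply: DeriveDef => //.
  exact: (derivable_mxP f x 1).1.
have fx : derivable f x 1.
  by apply/derivable_mxP => i j; exact: ex_derive.
apply: DeriveDef => //; rewrite derive_mx//.
by apply/matrixP => i j; rewrite mxE derive_val.
Qed.

Section coordinates.
Context {R : realType} {n : nat}.
Implicit Types (v : R -> 'cV[R[i]]_n) (F : set_system R).

Lemma cvgC_coordP v F (l : 'cV[R[i]]_n) : Filter F ->
  cvgC v F l <-> forall i,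
    complex.Re (v x i 0) @[x --> F] --> complex.Re (l i 0) /\
    complex.Im (v x i 0) @[x --> F] --> complex.Im (l i 0).
Proof.
move=> FF; split=> [[/cvg_mxP vr /cvg_mxP vi] i|vl].
  have := vr i 0; have := vi i 0; rewrite !mxE.
  by under eq_cvg do rewrite mxE; move=> ?; under eq_cvg do rewrite mxE.
split; apply/cvg_mxP => i j; rewrite ord1 mxE; under eq_cvg do rewrite mxE.
  exact: (vl i).1.
exact: (vl i).2.
Qed.

Lemma is_deriveC_coordP v (x : R) (d : 'cV[R[i]]_n) :
  is_deriveC x v d <-> forall i,
    is_derive x 1 (fun t => complex.Re (v t i 0)) (complex.Re (d i 0)) /\
    is_derive x 1 (fun t => complex.Im (v t i 0)) (complex.Im (d i 0)).
Proof.
split=> [[/is_derive_mxP vr /is_derive_mxP vi] i|vl].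
  have := vr i 0; have := vi i 0; rewrite !mxE.
  by under eq_fun do rewrite mxE; move=> ?; under eq_fun do rewrite mxE.
split; apply/is_derive_mxP => i j; rewrite ord1 mxE; under eq_fun do rewrite mxE.
  exact: (vl i).1.
exact: (vl i).2.
Qed.

End coordinates.

Section complex_linear_maps.
Context {R : realType}.

Lemma Re_mulmx (m n : nat) (B : 'M[R[i]]_(m, n)) (u : 'cV[R[i]]_n) i :
  complex.Re ((B *m u) i 0) = \sum_k
    (complex.Re (B i k) * complex.Re (u k 0) -
     complex.Im (B i k) * complex.Im (u k 0)).
Proof.
rewrite mxE (big_morph (@complex.Re R) (id1 := 0) (op1 := +%R))//.
  by apply: eq_bigr => k _; case: (B i k) => a b; case: (u k 0).
by move=> [a b] [c d].
Qed.

Lemma Im_mulmx (m n : nat) (B : 'M[R[i]]_(m, n)) (u : 'cV[R[i]]_n) i :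
  complex.Im ((B *m u) i 0) = \sum_k
    (complex.Re (B i k) * complex.Im (u k 0) +
     complex.Im (B i k) * complex.Re (u k 0)).
Proof.
rewrite mxE (big_morph (@complex.Im R) (id1 := 0) (op1 := +%R))//.
  by apply: eq_bigr => k _; case: (B i k) => a b; case: (u k 0).
by move=> [a b] [c d].
Qed.

Lemma cvgC_mulmx (m n : nat) (B : 'M[R[i]]_(m, n)) (v : R -> 'cV[R[i]]_n)
    (F : set_system R) (l : 'cV[R[i]]_n) : Filter F ->
  cvgC v F l -> cvgC (fun x => B *m v x) F (B *m l).
Proof.
move=> FF /cvgC_coordP vl; apply/cvgC_coordP => i.
split.
- rewrite Re_mulmx; under eq_cvg do rewrite Re_mulmx.
  apply: cvg_big => [|k _]; first exact: add_continuous.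
  by have [? ?] := vl k; apply: cvgB; apply: cvgMl_tmp.
- rewrite Im_mulmx; under eq_cvg do rewrite Im_mulmx.
  apply: cvg_big => [|k _]; first exact: add_continuous.
  by have [? ?] := vl k; apply: cvgD; apply: cvgMl_tmp.
Qed.

Lemma is_deriveC_mulmx (m n : nat) (B : 'M[R[i]]_(m, n)) (v : R -> 'cV[R[i]]_n)
    (x : R) (d : 'cV[R[i]]_n) :
  is_deriveC x v d -> is_deriveC x (fun t => B *m v t) (B *m d).
Proof.
move=> /is_deriveC_coordP vd; apply/is_deriveC_coordP => i; split.
- rewrite Re_mulmx; under eq_fun do rewrite Re_mulmx.
  rewrite -[X in is_derive _ _ X]fct_sumE.
  apply: is_derive_sum => k; have [? ?] := vd k.
  exact: is_deriveB.
- rewrite Im_mulmx; under eq_fun do rewrite Im_mulmx.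
  rewrite -[X in is_derive _ _ X]fct_sumE.
  apply: is_derive_sum => k; have [? ?] := vd k.
  exact: is_deriveD.
Qed.

Variable n : nat.
Implicit Types (v : R -> 'cV[R[i]]_n) (F : set_system R).

Lemma cvgCB v w F (l k : 'cV[R[i]]_n) : Filter F ->
  cvgC v F l -> cvgC w F k -> cvgC (fun x => v x - w x) F (l - k).
Proof.
move=> FF [vr vi] [wr wi]; split; rewrite raddfB.
- rewrite (_ : RePart _ = RePart v - RePart w); first exact: cvgB.
  by apply/funext => x; rewrite /RePart raddfB.
- rewrite (_ : ImPart _ = ImPart v - ImPart w); first exact: cvgB.
  by apply/funext => x; rewrite /ImPart raddfB.
Qed.

Lemma is_deriveCB v w (x : R) (d e : 'cV[R[i]]_n) :
  is_deriveC x v d -> is_deriveC x w e -> is_deriveC x (fun t => v t - w t) (d - e).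
Proof.
move=> [vr vi] [wr wi]; split; rewrite raddfB.
- rewrite (_ : RePart _ = RePart v - RePart w); first exact: is_deriveB.
  by apply/funext => t; rewrite /RePart raddfB.
- rewrite (_ : ImPart _ = ImPart v - ImPart w); first exact: is_deriveB.
  by apply/funext => t; rewrite /ImPart raddfB.
Qed.

Lemma cvgC_unique v F (l k : 'cV[R[i]]_n) : ProperFilter F ->
  cvgC v F l -> cvgC v F k -> l = k.
Proof.
move=> FF [lr li] [kr ki].
have /matrixP er : map_mx (@complex.Re R) l = map_mx (@complex.Re R) k.
  exact: (cvg_unique _ lr kr).
have /matrixP ei : map_mx (@complex.Im R) l = map_mx (@complex.Im R) k.
  exact: (cvg_unique _ li ki).
apply/matrixP => i j; move: (er i j) (ei i j); rewrite !mxE.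
by case: (l i j) (k i j) => [a b] [c d] /= -> ->.
Qed.

Lemma near_eq_cvgC v w F (l : 'cV[R[i]]_n) : Filter F ->
  (\forall x \near F, v x = w x) -> cvgC v F l -> cvgC w F l.
Proof.
move=> FF vw [vr vi]; split.
- by apply: cvg_trans vr; apply: near_eq_cvg; apply: filterS vw => x; rewrite /RePart => ->.
- by apply: cvg_trans vi; apply: near_eq_cvg; apply: filterS vw => x; rewrite /ImPart => ->.
Qed.

Lemma near_eq_is_deriveC v w (x : R) (d : 'cV[R[i]]_n) :
  (\forall y \near x, v y = w y) -> is_deriveC x v d -> is_deriveC x w d.
Proof.
by move=> vw [vr vi]; split; [apply: near_eq_is_derive vr | apply: near_eq_is_derive vi];
  apply: filterS vw => y; rewrite /RePart /ImPart => ->.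
Qed.

End complex_linear_maps.

(* The derivative 2 Re(s_j) |w_j|^2 of |w_j|^2 has constant sign, so |w_j|^2
   increases towards its limit 0 along F. *)
Lemma diag_ode_vanishes (R : realType) (n : nat) (I : interval R)
    (F : set_system R) (s : 'rV[R[i]]_n) (w : R -> 'cV[R[i]]_n) :
  ProperFilter F ->
  (forall x, x \in I -> is_deriveC x w (diag_mx s *m w x)) ->
  cvgC w F 0 ->
  (forall x j, x \in I ->
     \forall y \near F, y \in I /\ 0 <= (y - x) * complex.Re (s 0 j)) ->
  forall x, x \in I -> w x = 0.
Proof.
move=> FF wd w0 dir x xI; apply/colP => j; rewrite mxE.
pose a t := complex.Re (w t j 0); pose b t := complex.Im (w t j 0).
pose m t := a t * a t + b t * b t.
have md t : t \in I -> is_derive t 1 m (2 * complex.Re (s 0 j) * m t).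
  move=> tI; have /is_deriveC_coordP/(_ j) [ad bd] := wd t tI.
  have := is_deriveD (is_deriveM ad ad) (is_deriveM bd bd).
  move=> /is_derive_eq; apply.
  rewrite mul_diag_mx !mxE /m /a /b; case: (s 0 j) (w t j 0) => p q [c d] /=.
  by rewrite /GRing.scale /=; ring.
have m0 : m y @[y --> F] --> 0.
  have /cvgC_coordP/(_ j)[] := w0; rewrite !mxE /= => a0 b0.
  have := cvgD (cvgM a0 a0) (cvgM b0 b0).
  by rewrite mulr0 addr0; exact.
have mge0 t : 0 <= m t by rewrite /m -!expr2 addr_ge0// sqr_ge0.
(* Mean value theorem for m on [c, d], which lies in I since intervals are convex. *)
have mono c d : c \in I -> d \in I -> c <= d -> exists2 e, e \in I &
    m d - m c = 2 * complex.Re (s 0 j) * m e * (d - c).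
  move=> cI dI cd.
  have sub t : t \in `[c, d] -> t \in I.
    move: cI dI; case: (I) => l r; rewrite !itv_boundlr.
    move=> /andP[lc _] /andP[_ dr] /andP[ct td].
    by rewrite (le_trans lc ct) (le_trans td dr).
  have [||e ecd ->] := @MVT_segment R m (fun t => 2 * complex.Re (s 0 j) * m t) c d cd.
  - by move=> t tcd; apply: md; apply: sub; apply: subset_itv_oo_cc tcd.
  - apply: derivable_within_continuous => t tcd.
    by have := md t (sub t tcd) => ?; exact: ex_derive.
  - by exists e => //; exact: sub.
(* The direction hypothesis gives m x <= m y for y close to the end F, and m y tends to 0 there. *)
have mx : m x <= 0.
  apply: (cvgr_to_ge m0); apply: filterS (dir x j xI) => y [yI ysx].
  have [xy|/ltW yx] := leP x y.
  - have [e _] := mono _ _ xI yI xy.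
    have := mge0 e; nra.
  - have [e _] := mono _ _ yI xI yx.
    have := mge0 e; nra.
have := mge0 x; move: mx; rewrite /m /a /b; case: (w x j 0) => p q /= h1 h2.
by apply/eqP; rewrite eq_complex /=; apply/andP; split; apply/eqP; nra.
Qed.

(** * Exponential solutions *)

Lemma is_derive_scale_arg (R : realType) (f df : R -> R) (a x : R) :
  (forall y, is_derive y (1 : R) f (df y)) ->
  is_derive x (1 : R) (fun y => f (a * y)) (a * df (a * x)).
Proof.
move=> fd; have gd : is_derive x (1 : R) (fun y => a * y) a.
  by apply: (is_derive_eq (is_deriveZ a (is_derive_id x (1 : R)))); rewrite /GRing.scale/= mulr1.
by rewrite mulrC; exact: (is_derive1_comp (fd (a * x)) gd).
Qed.

Lemma is_derive_exp_cos (R : realType) (a b x : R) :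
  is_derive x (1 : R) (fun y => expR (a * y) * cos (b * y))
    (a * (expR (a * x) * cos (b * x)) - b * (expR (a * x) * sin (b * x))).
Proof.
have ed := is_derive_scale_arg a x (@is_derive_expR R).
have cd := is_derive_scale_arg b x (@is_derive_cos R).
apply: (is_derive_eq (is_deriveM ed cd)).
by rewrite /GRing.scale/=; ring.
Qed.

Lemma is_derive_exp_sin (R : realType) (a b x : R) :
  is_derive x (1 : R) (fun y => expR (a * y) * sin (b * y))
    (a * (expR (a * x) * sin (b * x)) + b * (expR (a * x) * cos (b * x))).
Proof.
have ed := is_derive_scale_arg a x (@is_derive_expR R).
have cd := is_derive_scale_arg b x (@is_derive_sin R).
apply: (is_derive_eq (is_deriveM ed cd)).
by rewrite /GRing.scale/=; ring.
Qed.

Lemma cvg_expR_Ny (R : realType) : @expR R y @[y --> -oo%R] --> 0.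
Proof. by apply/cvgNy_compNP; exact: cvgr_expR. Qed.

Lemma cvg0_mul_bounded (R : realType) (F : set_system R) (f g : R -> R) :
  Filter F -> (forall x, `|g x| <= 1) -> f @ F --> 0 -> f x * g x @[x --> F] --> 0.
Proof.
move=> FF g1 f0; apply/cvgr0Pnorm_le => e e0.
move/cvgr0Pnorm_le : f0 => /(_ e e0); apply: filterS => x fx.
by rewrite normrM (le_trans _ fx)// ler_piMr.
Qed.

Section exponential_solutions.
Context {R : realType} {n : nat}.
Variable s : 'rV[R[i]]_n.

(** The exponential e^(a x) for complex a and real x, given by its real and imaginary parts so that
    real calculus applies to each. *)
Definition expC (a : R[i]) (x : R) : R[i] :=
  (expR (complex.Re a * x) * cos (complex.Im a * x)) +i*
  (expR (complex.Re a * x) * sin (complex.Im a * x)).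

(** The solution of w' = diag(s) w with w(0) = c. *)
Definition exp_sol (c : 'cV[R[i]]_n) (x : R) : 'cV[R[i]]_n :=
  \col_j (expC (s 0 j) x * c j 0).

Lemma exp_sol0 c : exp_sol c 0 = c.
Proof.
by apply/colP => j; rewrite mxE /expC !mulr0 expR0 cos0 sin0 mul1r mulr0 mul1r.
Qed.

Lemma Re_exp_sol c (x : R) j : complex.Re (exp_sol c x j 0) =
  expR (complex.Re (s 0 j) * x) * cos (complex.Im (s 0 j) * x) * complex.Re (c j 0)
  - expR (complex.Re (s 0 j) * x) * sin (complex.Im (s 0 j) * x) * complex.Im (c j 0).
Proof. by rewrite mxE /expC; case: (c j 0) => p q. Qed.

Lemma Im_exp_sol c (x : R) j : complex.Im (exp_sol c x j 0) =
  expR (complex.Re (s 0 j) * x) * cos (complex.Im (s 0 j) * x) * complex.Im (c j 0)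
  + expR (complex.Re (s 0 j) * x) * sin (complex.Im (s 0 j) * x) * complex.Re (c j 0).
Proof. by rewrite mxE /expC; case: (c j 0) => p q. Qed.

Lemma is_deriveC_exp_sol c (x : R) :
  is_deriveC x (exp_sol c) (diag_mx s *m exp_sol c x).
Proof.
apply/is_deriveC_coordP => j.
have cd := is_derive_exp_cos (complex.Re (s 0 j)) (complex.Im (s 0 j)) x.
have sd := is_derive_exp_sin (complex.Re (s 0 j)) (complex.Im (s 0 j)) x.
have mulRe (a b : R[i]) : complex.Re (a * b) =
    complex.Re a * complex.Re b - complex.Im a * complex.Im b.
  by case: a b => ? ? [].
have mulIm (a b : R[i]) : complex.Im (a * b) =
    complex.Re a * complex.Im b + complex.Im a * complex.Re b.
  by case: a b => ? ? [].
rewrite mul_diag_mx mxE mulRe mulIm Re_exp_sol Im_exp_sol; split.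
- under eq_fun do rewrite Re_exp_sol.
  have := is_deriveB (is_deriveM cd (is_derive_cst (complex.Re (c j 0)) x (1 : R)))
                     (is_deriveM sd (is_derive_cst (complex.Im (c j 0)) x (1 : R))).
  move=> /is_derive_eq; apply.
  by rewrite /GRing.scale /cst /=; ring.
- under eq_fun do rewrite Im_exp_sol.
  have := is_deriveD (is_deriveM cd (is_derive_cst (complex.Im (c j 0)) x (1 : R)))
                     (is_deriveM sd (is_derive_cst (complex.Re (c j 0)) x (1 : R))).
  move=> /is_derive_eq; apply.
  by rewrite /GRing.scale /cst /=; ring.
Qed.

Lemma cvgC_exp_sol c (F : set_system R) : Filter F ->
  (forall j, complex.Re (s 0 j) * x @[x --> F] --> -oo%R) ->
  cvgC (exp_sol c) F 0.
Proof.
move=> FF sF; apply/cvgC_coordP => j; rewrite !mxE /=.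
have e0 : expR (complex.Re (s 0 j) * x) @[x --> F] --> 0.
  exact: (cvg_comp _ _ (sF j) (@cvg_expR_Ny R)).
have c0 := cvg0_mul_bounded FF
  (fun x => cos_max (complex.Im (s 0 j) * x)) e0.
have s0 := cvg0_mul_bounded FF
  (fun x => sin_max (complex.Im (s 0 j) * x)) e0.
split.
- under eq_cvg do rewrite Re_exp_sol.
  have := cvgB (cvgMr_tmp (b := complex.Re (c j 0)) c0)
               (cvgMr_tmp (b := complex.Im (c j 0)) s0).
  by rewrite !mul0r subr0; exact.
- under eq_cvg do rewrite Im_exp_sol.
  have := cvgD (cvgMr_tmp (b := complex.Im (c j 0)) c0)
               (cvgMr_tmp (b := complex.Re (c j 0)) s0).
  by rewrite !mul0r addr0; exact.
Qed.

End exponential_solutions.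

(** * One-sided limits and smoothness up to the origin *)

Lemma derivable1_continuous (R : realType) (V : normedModType R) (f : R -> V)
    (x : R) : derivable f x 1 -> {for x, continuous f}.
Proof. by move=> /derivable1_diffP; exact: differentiable_continuous. Qed.

Lemma is_deriveC_cvg_at_right (R : realType) (n : nat) (v : R -> 'cV[R[i]]_n)
    (x : R) (d : 'cV[R[i]]_n) : is_deriveC x v d -> cvgC v x^'+ (v x).
Proof.
move=> [[vr _] [vi _]]; split; apply: cvg_at_right_filter.
  exact: derivable1_continuous vr.
exact: derivable1_continuous vi.
Qed.

Lemma is_deriveC_cvg_at_left (R : realType) (n : nat) (v : R -> 'cV[R[i]]_n)
    (x : R) (d : 'cV[R[i]]_n) : is_deriveC x v d -> cvgC v x^'- (v x).
Proof.
move=> [[vr _] [vi _]]; split; apply: cvg_at_left_filter.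
  exact: derivable1_continuous vr.
exact: derivable1_continuous vi.
Qed.

(** Derivatives are local, so agreement on an open set passes to all orders. This transfers
    smoothness from globally defined solutions to functions glued at 0. *)
Lemma eq_derive1n_open (R : realType) (V : normedModType R) (A : set R)
    (g h : R -> V) : open A -> {in A, g =1 h} ->
  forall k, {in A, derive1n k g =1 derive1n k h}.
Proof.
move=> oA gh; elim=> [|k IH] x xA; first exact: gh.
rewrite !derive1nS !derive1E; apply: near_eq_derive.
rewrite inE in xA; apply: filterS (open_nbhs_nbhs (conj oA xA)) => y yA.
by apply: IH; rewrite inE.
Qed.

Definition smoothR (R : realType) (V : normedModType R) (h : R -> V) : Prop :=
  forall k x, derivable (derive1n k h) x 1.

(** The k-th derivative of B w is B P^k w, again a constant matrix times w, so induction closes on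
    this form. The factor B covers both components of a solution: z itself, and v as a multiple of P
    z. *)
Lemma smoothR_linear_ode (R : realType) (n : nat) (P : 'M[R[i]]_n)
    (w : R -> 'cV[R[i]]_n) (B : 'M[R[i]]_n) :
  (forall x, is_deriveC x w (P *m w x)) ->
  smoothR (RePart (fun x => B *m w x)) /\ smoothR (ImPart (fun x => B *m w x)).
Proof.
move=> wP.
have wBP (A : 'M[R[i]]_n) x := is_deriveC_mulmx A (wP x).
have dn k : exists A : 'M[R[i]]_n,
    derive1n k (RePart (fun x => B *m w x)) = RePart (fun x => A *m w x) /\
    derive1n k (ImPart (fun x => B *m w x)) = ImPart (fun x => A *m w x).
  elim: k => [|k [A [rE iE]]]; first by exists B.
  exists (A *m P); rewrite !derive1nS rE iE; split; apply/funext => x.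
    by have [? _] := wBP A x; rewrite derive1E derive_val mulmxA.
  by have [_ ?] := wBP A x; rewrite derive1E derive_val mulmxA.
split=> k x; have [A [rE iE]] := dn k.
  by rewrite rE; have [[]] := wBP A x.
by rewrite iE; have [_ []] := wBP A x.
Qed.

(** Since h is smooth across 0, its derivatives are continuous there, and their values at 0 serve as
    the one-sided limits for g. *)
Lemma smooth_pos_smoothR (R : realType) (n : nat) (g h : R -> 'cV[R]_n) :
  (forall x, 0 < x -> g x = h x) -> smoothR h -> smooth_pos g.
Proof.
move=> gh hE k.
have E : {in [set x : R | 0 < x], derive1n k g =1 derive1n k h}.
  by apply: eq_derive1n_open; [exact: open_gt | move=> x; rewrite inE => /gh].
split=> [x x0|].
  apply: near_eq_derivable (hE k x).
  by apply: filterS (lt_nbhsr x0) => y y0; apply/esym/E; rewrite inE.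
apply/cvg_ex; exists (derive1n k h 0).
have := cvg_at_right_filter (derivable1_continuous (hE k 0)).
apply: cvg_trans; apply: near_eq_cvg.
by apply: filterS (nbhs_right_gt 0) => y y0; apply/esym/E; rewrite inE.
Qed.

Lemma smooth_neg_smoothR (R : realType) (n : nat) (g h : R -> 'cV[R]_n) :
  (forall x, x < 0 -> g x = h x) -> smoothR h -> smooth_neg g.
Proof.
move=> gh hE k.
have E : {in [set x : R | x < 0], derive1n k g =1 derive1n k h}.
  by apply: eq_derive1n_open; [exact: open_lt | move=> x; rewrite inE => /gh].
split=> [x x0|].
  apply: near_eq_derivable (hE k x).
  by apply: filterS (lt_nbhsl x0) => y y0; apply/esym/E; rewrite inE.
apply/cvg_ex; exists (derive1n k h 0).
have := cvg_at_left_filter (derivable1_continuous (hE k 0)).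
apply: cvg_trans; apply: near_eq_cvg.
by apply: filterS (nbhs_left_lt 0) => y y0; apply/esym/E; rewrite inE.
Qed.

(** * Solutions on a half-line *)

Section halfline.
Context {R : realType} {n : nat}.
Variables (Q : 'M[R]_n) (lambda : R[i]) (U P : 'M[R[i]]_n) (s t : 'rV[R[i]]_n).
Hypothesis U_unit : U \in unitmx.
Hypothesis UQ : U *m toC Q = diag_mx (s + t) *m U.
Hypothesis st : forall j, s 0 j * t 0 j = - lambda.
Hypothesis UP : U *m P = diag_mx s *m U.

(** The function w = U (lambda v - P z) solves w' = diag(t) w. The last hypothesis says that going
    towards F is the direction in which the |w_j| do not decrease, so their limit 0 forces them to
    vanish. Leaving I and F abstract treats both half-lines at once. *)
Lemma halfline_relation (I : interval R) (F : set_system R)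
    (v z : R -> 'cV[R[i]]_n) :
  ProperFilter F ->
  (forall x, x \in I -> is_deriveC x v (toC Q *m v x + z x)) ->
  (forall x, x \in I -> is_deriveC x z (lambda *: v x)) ->
  cvgC v F 0 -> cvgC z F 0 ->
  (forall x j, x \in I ->
     \forall y \near F, y \in I /\ 0 <= (y - x) * complex.Re (t 0 j)) ->
  forall x, x \in I -> lambda *: v x = P *m z x.
Proof.
move=> FF vd zd v0 z0 dir x xI.
pose w x := (lambda *: U) *m v x - (U *m P) *m z x.
have w0 : w x = 0.
  apply: (diag_ode_vanishes FF _ _ dir xI) => [y yI|].
    (* This identity turns - t s U z into lambda U z, the contribution of the term z in v' = Q v +
       z; the terms lambda s U v cancel. *)
    have ts : diag_mx t *m diag_mx s = (- lambda)%:M :> 'M[R[i]]_n.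
      rewrite mulmx_diag; apply/matrixP => i j; rewrite !mxE.
      by rewrite mulrC st.
    have := is_deriveCB (is_deriveC_mulmx (lambda *: U) (vd y yI))
                        (is_deriveC_mulmx (U *m P) (zd y yI)).
    congr (is_deriveC _ _ _).
    have -> : (lambda *: U) *m (toC Q *m v y + z y) = lambda *:
        (diag_mx s *m (U *m v y) + diag_mx t *m (U *m v y) + U *m z y).
      by rewrite -scalemxAl mulmxDr !mulmxA UQ [diag_mx _]linearD/= !mulmxDl.
    have -> : (U *m P) *m (lambda *: v y) = lambda *: (diag_mx s *m (U *m v y)).
      by rewrite -scalemxAr UP mulmxA.
    rewrite /w mulmxBr -scalemxAl -scalemxAr UP !mulmxA ts mul_scalar_mx.
    rewrite -scalemxAl scaleNr opprK -scalerBr -scalerDr; congr (_ *: _).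
    by rewrite -[X in X - _]addrA [X in X - _]addrC addrK.
  have := cvgCB _ (cvgC_mulmx (lambda *: U) _ v0) (cvgC_mulmx (U *m P) _ z0).
  by rewrite !mulmx0 subr0; exact.
apply: (can_inj (mulKmx U_unit)); apply/eqP; rewrite -subr_eq0; apply/eqP.
by rewrite -[RHS]w0 /w -scalemxAl scalemxAr mulmxA.
Qed.

(** Meant for F a one-sided neighbourhood filter of 0: U z solves a diagonal system whose solutions
    grow in modulus towards 0, so a zero limit there leaves only z = 0. *)
Lemma halfline_zero (I : interval R) (F : set_system R) (z : R -> 'cV[R[i]]_n) :
  ProperFilter F ->
  (forall x, x \in I -> is_deriveC x z (P *m z x)) ->
  cvgC z F 0 ->
  (forall x j, x \in I ->
     \forall y \near F, y \in I /\ 0 <= (y - x) * complex.Re (s 0 j)) ->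
  forall x, x \in I -> z x = 0.
Proof.
move=> FF zd z0 dir x xI; apply: (can_inj (mulKmx U_unit)); rewrite mulmx0.
apply: (diag_ode_vanishes (w := fun x => U *m z x) FF _ _ dir xI) => [y yI|].
  by rewrite mulmxA -UP -mulmxA; exact: is_deriveC_mulmx (zd y yI).
by rewrite -(mulmx0 _ U); exact: cvgC_mulmx.
Qed.

(** Here Q stands on the left of P, unlike in the defining equation of P. With v = P z / lambda and
    z' = P z, this order gives v' = P^2 z / lambda = Q v + z. *)
Lemma diag_quadratic : P *m P = toC Q *m P + lambda%:M.
Proof.
apply: (can_inj (mulKmx U_unit)); rewrite mulmxDr !mulmxA UP UQ.
rewrite -!mulmxA UP !mulmxA mul_mx_scalar -mul_scalar_mx -mulmxDl; congr (_ *m _).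
rewrite !mulmx_diag; apply/matrixP => i j; rewrite !mxE -mulrnDl; congr (_ *+ _).
by rewrite mulrDl [t 0 i * _]mulrC st addrNK.
Qed.

(** The solution is z = U^-1 e^(x diag(s)) U z0 and v = P z / lambda, defined on the whole line, so
    its one-sided limits at 0 are plain values. Decay is stated for a general filter to serve P^+ at
    +oo and P^- at -oo. *)
Lemma halfline_solution_ex (z0 : 'cV[R[i]]_n) : lambda != 0 ->
  exists v z : R -> 'cV[R[i]]_n,
  [/\ v 0 = lambda^-1 *: (P *m z0) /\ z 0 = z0,
      forall x, is_deriveC x v (toC Q *m v x + z x) /\
                is_deriveC x z (lambda *: v x),
      [/\ smoothR (RePart v), smoothR (ImPart v), smoothR (RePart z) &
          smoothR (ImPart z)] &
      forall F : set_system R, Filter F ->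
        (forall j, complex.Re (s 0 j) * x @[x --> F] --> -oo%R) ->
        cvgC v F 0 /\ cvgC z F 0].
Proof.
move=> lambda_neq0; pose z x := invmx U *m exp_sol s (U *m z0) x.
have PU : P *m invmx U = invmx U *m diag_mx s.
  by apply: (can_inj (mulKmx U_unit)); rewrite mulmxA UP mulmxK// mulKVmx.
have zP x : is_deriveC x z (P *m z x).
  have := is_deriveC_mulmx (invmx U) (is_deriveC_exp_sol s (U *m z0) x).
  by rewrite mulmxA -PU -mulmxA; exact.
pose v x := (lambda^-1 *: P) *m z x.
exists v, z; split.
- have z00 : z 0 = z0 by rewrite /z exp_sol0 mulKmx.
  by rewrite /v z00 -scalemxAl.
- move=> x; split.
    have := is_deriveC_mulmx (lambda^-1 *: P) (zP x).
    congr (is_deriveC _ _ _).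
    rewrite /v -!scalemxAl (mulmxA P P) diag_quadratic mulmxDl scalerDr.
    by rewrite mul_scalar_mx scalerA mulVf// scale1r -scalemxAr (mulmxA _ P).
  by rewrite /v -scalemxAl scalerA mulfV// scale1r.
- have [vr vi] := smoothR_linear_ode (lambda^-1 *: P) zP.
  have [zr zi] := smoothR_linear_ode 1%:M zP.
  have zE : (fun x => 1%:M *m z x) = z by apply/funext => x; rewrite mul1mx.
  rewrite zE in zr zi.
  by split; [exact: vr | exact: vi | exact: zr | exact: zi].
- move=> F FF sF.
  have z_0 : cvgC z F 0.
    have := cvgC_mulmx (invmx U) FF (cvgC_exp_sol (U *m z0) FF sF).
    by rewrite mulmx0; exact.
  split; last exact: z_0.
  have := cvgC_mulmx (lambda^-1 *: P) FF z_0.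
  by rewrite mulmx0; exact.
Qed.

End halfline.

(** * Matching the two half-lines at the jump *)

Lemma eigenvalue_Dfun0 (R : realType) (n : nat) (Qp Qm S : 'M[R]_n)
    (lambda : R[i]) :
  Qp^T = Qp -> Qm^T = Qm -> lambda != 0 -> 0 <= complex.Re lambda ->
  spectral_eigenvalue Qp Qm S lambda -> Dfun Qp Qm S lambda = 0.
Proof.
move=> Qp_sym Qm_sym l0 lRe [v [z [[x0 x00 vz0] _ [odeP odeM]]]].
move=> [va [za [vm vp zm zp]]] [vpy zpy vmy zmy].
have [Up Up1 [[sp tp] /= [UpQ stp stp0 UpP _]]] := Pplus_Pminus_diag Qp_sym l0 lRe.
(* P^- carries the second family of roots, those with positive real part. The pair is named in
   reverse so that [sm] always denotes the roots of P^-, as the half-line lemmas expect. *)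
have [Um Um1 [[tm sm] /= [UmQ' stm' stm0 _ UmP]]] := Pplus_Pminus_diag Qm_sym l0 lRe.
have UmQ : Um *m toC Qm = diag_mx (sm + tm) *m Um by rewrite addrC.
have stm j : sm 0 j * tm 0 j = - lambda by rewrite mulrC.
set Pp := Pplus Qp lambda in UpP *; set Pm := Pminus Qm lambda in UmP *.
have relP x : x \in `]0, +oo[ -> lambda *: v x = Pp *m z x.
  apply: (halfline_relation Up1 UpQ stp UpP _ _ _ vpy zpy).
  - by move=> y; rewrite in_itv/= andbT => /odeP[].
  - by move=> y; rewrite in_itv/= andbT => /odeP[].
  - move=> y j _; near=> u; split.
      by rewrite in_itv/= andbT; near: u; exact: nbhs_pinfty_gt.
    rewrite mulr_ge0 ?(ltW (stp0 j).2)// subr_ge0.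
    by near: u; apply: nbhs_pinfty_ge; exact: num_real.
have relM x : x \in `]-oo, 0[ -> lambda *: v x = Pm *m z x.
  apply: (halfline_relation Um1 UmQ stm UmP _ _ _ vmy zmy).
  - by move=> y; rewrite in_itv/= => /odeM[].
  - by move=> y; rewrite in_itv/= => /odeM[].
  - move=> y j _; near=> u; split.
      by rewrite in_itv/=; near: u; exact: nbhs_ninfty_lt.
    rewrite mulr_le0 ?(ltW (stm0 j).1)// subr_le0.
    by near: u; apply: nbhs_ninfty_le; exact: num_real.
(* The relations lambda v = P z pass to the one-sided limits at 0. *)
have jumpP : lambda *: (toC S *m va) = Pp *m za.
  rewrite -mul_scalar_mx.
  apply: (cvgC_unique (F := 0^'+) _ (cvgC_mulmx lambda%:M _ vp)).
  apply: near_eq_cvgC (cvgC_mulmx Pp _ zp).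
  near=> u; rewrite mul_scalar_mx relP// in_itv/= andbT.
  by near: u; exact: nbhs_right_gt.
have jumpM : lambda *: va = Pm *m za.
  rewrite -mul_scalar_mx.
  apply: (cvgC_unique (F := 0^'-) _ (cvgC_mulmx lambda%:M _ vm)).
  apply: near_eq_cvgC (cvgC_mulmx Pm _ zm).
  near=> u; rewrite mul_scalar_mx relM// in_itv/=.
  by near: u; exact: nbhs_left_lt.
(* If z(0) = 0, then z vanishes on both half-lines, and so does v because lambda v = P z, against
   nontriviality at [x0]. *)
have za0 : za != 0.
  apply: contraTneq vz0 => za0; rewrite za0 in zp zm.
  have zx0 : z x0 = 0.
    have [xlt|xgt|xeq] := ltgtP x0 0; last by rewrite xeq eqxx in x00.
    - apply: (halfline_zero Um1 UmP (I := `]-oo, 0[) _ _ zm).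
      + by move=> y yI; rewrite -relM//; move: yI; rewrite in_itv/= => /odeM[].
      + move=> y j; rewrite in_itv/= => y0; near=> u; split.
          by rewrite in_itv/=; near: u; exact: nbhs_left_lt.
        rewrite mulr_ge0 ?(ltW (stm0 j).2)// subr_ge0.
        by near: u; exact: nbhs_left_ge.
      + by rewrite in_itv/=.
    - apply: (halfline_zero Up1 UpP (I := `]0, +oo[) _ _ zp).
      + by move=> y yI; rewrite -relP//; move: yI; rewrite in_itv/= andbT => /odeP[].
      + move=> y j; rewrite in_itv/= andbT => y0; near=> u; split.
          by rewrite in_itv/= andbT; near: u; exact: nbhs_right_gt.
        rewrite mulr_le0 ?(ltW (stp0 j).1)// subr_le0.
        by near: u; exact: nbhs_right_le.
      + by rewrite in_itv/= andbT.
  have : lambda *: v x0 = 0.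
    have [xlt|xgt|xeq] := ltgtP x0 0; last by rewrite xeq eqxx in x00.
    - by rewrite relM ?in_itv//= zx0 mulmx0.
    - by rewrite relP ?in_itv/= ?andbT// zx0 mulmx0.
  by move/eqP; rewrite scaler_eq0 (negPf l0)/= => /eqP ->; rewrite zx0 eqxx.
(* [det0P] provides row vectors in the left kernel; transposing turns the column [za] of the right
   kernel into one. *)
rewrite /Dfun -/Pp -/Pm -det_tr; apply/eqP/det0P; exists za^T.
  by rewrite trmx_eq0.
rewrite -trmx_mul mulmxBl -jumpP -mulmxA -jumpM -scalemxAr subrr.
by rewrite trmx0.
Unshelve. all: by end_near. Qed.

Lemma Dfun0_eigenvalue (R : realType) (n : nat) (Qp Qm S : 'M[R]_n)
    (lambda : R[i]) :
  Qp^T = Qp -> Qm^T = Qm -> lambda != 0 -> 0 <= complex.Re lambda ->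
  Dfun Qp Qm S lambda = 0 -> spectral_eigenvalue Qp Qm S lambda.
Proof.
move=> Qp_sym Qm_sym l0 lRe D0.
have [Up Up1 [[sp tp] /= [UpQ stp stp0 UpP _]]] := Pplus_Pminus_diag Qp_sym l0 lRe.
have [Um Um1 [[tm sm] /= [UmQ' stm' stm0 _ UmP]]] := Pplus_Pminus_diag Qm_sym l0 lRe.
have UmQ : Um *m toC Qm = diag_mx (sm + tm) *m Um by rewrite addrC.
have stm j : sm 0 j * tm 0 j = - lambda by rewrite mulrC.
move: D0; rewrite /Dfun.
set Pp := Pplus Qp lambda in UpP *; set Pm := Pminus Qm lambda in UmP *.
rewrite -det_tr => /eqP/det0P[u u0 uD].
pose z0 := u^T.
have z00 : z0 != 0 by rewrite trmx_eq0.
have jump : Pp *m z0 = toC S *m (Pm *m z0).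
  apply/eqP; rewrite mulmxA -subr_eq0 -mulmxBl -trmx_eq0 trmx_mul trmxK.
  by rewrite uD.
have [vp [zp [[vp0 zp0] odeP [vpr vpi zpr zpi] decP]]] :=
  halfline_solution_ex Up1 UpQ stp UpP z0 l0.
have [vm [zm [[vm0 zm0] odeM [vmr vmi zmr zmi] decM]]] :=
  halfline_solution_ex Um1 UmQ stm UmP z0 l0.
(* The two global solutions are glued at 0; only the values off 0 are retained. *)
have [v vP vM] : exists2 v, (forall x, 0 < x -> v x = vp x) &
    (forall x, x < 0 -> v x = vm x).
  by exists (fun x => if 0 < x then vp x else vm x) => x; [move=> ->|move/ltW/le_gtF ->].
have [z zP zM] : exists2 z, (forall x, 0 < x -> z x = zp x) &
    (forall x, x < 0 -> z x = zm x).
  by exists (fun x => if 0 < x then zp x else zm x) => x; [move=> ->|move/ltW/le_gtF ->].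
have limP w w' (l : 'cV[R[i]]_n) : (forall x : R, 0 < x -> w x = w' x) ->
    cvgC w' 0^'+ l -> cvgC w 0^'+ l.
  move=> ww'; apply: near_eq_cvgC; near=> x; apply/esym/ww'.
  by near: x; exact: nbhs_right_gt.
have limM w w' (l : 'cV[R[i]]_n) : (forall x : R, x < 0 -> w x = w' x) ->
    cvgC w' 0^'- l -> cvgC w 0^'- l.
  move=> ww'; apply: near_eq_cvgC; near=> x; apply/esym/ww'.
  by near: x; exact: nbhs_left_lt.
have zlim : cvgC z 0^'+ z0.
  by apply: (limP _ _ _ zP); rewrite -zp0; exact: is_deriveC_cvg_at_right (odeP 0).2.
exists v, z; split.
(* Nontriviality is needed at a point other than 0: if z vanished for all x > 0, its right limit
   would be 0 instead of [z0]. *)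
- have [x x0 zx] : exists2 x, 0 < x & z x != 0.
    apply: contrapT => nz; move/eqP: z00; apply.
    apply: (cvgC_unique _ zlim); apply: (limP _ (fun=> 0)).
      by move=> x x0; apply/eqP; apply: contrapT => /negP zx; apply: nz; exists x.
    by split; exact: cvg_cst.
  by exists x; rewrite ?gt_eqF// zx orbT.
- split; split.
  + by apply: smooth_pos_smoothR vpr => x x0; rewrite /RePart vP.
  + by apply: smooth_pos_smoothR vpi => x x0; rewrite /ImPart vP.
  + by apply: smooth_neg_smoothR vmr => x x0; rewrite /RePart vM.
  + by apply: smooth_neg_smoothR vmi => x x0; rewrite /ImPart vM.
  + by apply: smooth_pos_smoothR zpr => x x0; rewrite /RePart zP.
  + by apply: smooth_pos_smoothR zpi => x x0; rewrite /ImPart zP.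
  + by apply: smooth_neg_smoothR zmr => x x0; rewrite /RePart zM.
  + by apply: smooth_neg_smoothR zmi => x x0; rewrite /ImPart zM.
- split=> x x0.
    rewrite (vP _ x0) (zP _ x0); have [vd zd] := odeP x; split.
      apply: near_eq_is_deriveC vd.
      by apply: filterS (lt_nbhsr x0) => y y0; rewrite vP.
    apply: near_eq_is_deriveC zd.
    by apply: filterS (lt_nbhsr x0) => y y0; rewrite zP.
  rewrite (vM _ x0) (zM _ x0); have [vd zd] := odeM x; split.
    apply: near_eq_is_deriveC vd.
    by apply: filterS (lt_nbhsl x0) => y y0; rewrite vM.
  apply: near_eq_is_deriveC zd.
  by apply: filterS (lt_nbhsl x0) => y y0; rewrite zM.
(* v(-0) is read off from lambda v = P^- z. The kernel relation [jump] then says that S maps it to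
   P^+ z0 / lambda, which is v(+0). *)
- exists (lambda^-1 *: (Pm *m z0)), z0; split; last exact: zlim.
  + by apply: (limM _ _ _ vM); rewrite -vm0; exact: is_deriveC_cvg_at_left (odeM 0).1.
  + apply: (limP _ _ _ vP); rewrite -scalemxAr -jump -vp0.
    exact: is_deriveC_cvg_at_right (odeP 0).1.
  + by apply: (limM _ _ _ zM); rewrite -zm0; exact: is_deriveC_cvg_at_left (odeM 0).2.
- have [|vpy zpy] := decP +oo%R _.
    move=> j; apply/cvgNry.
    rewrite (_ : - _ = fun x => - complex.Re (sp 0 j) * x); last first.
      by apply/funext => x; rewrite mulNr.
    by apply: gt0_cvgMry; [rewrite oppr_gt0 (stp0 j).1|exact: cvg_id].
  have [|vmy zmy] := decM -oo%R _.
    by move=> j; apply: gt0_cvgMrNy; [rewrite (stm0 j).2|exact: cvg_id].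
  split.
  + apply: near_eq_cvgC vpy; near=> x; apply/esym/vP.
    by near: x; exact: nbhs_pinfty_gt.
  + apply: near_eq_cvgC zpy; near=> x; apply/esym/zP.
    by near: x; exact: nbhs_pinfty_gt.
  + apply: near_eq_cvgC vmy; near=> x; apply/esym/vM.
    by near: x; exact: nbhs_ninfty_lt.
  + apply: near_eq_cvgC zmy; near=> x; apply/esym/zM.
    by near: x; exact: nbhs_ninfty_lt.
Unshelve. all: by end_near. Qed.

Theorem proposition4p1 (R : realType) (n : nat)
    (nn : 'cV[R]_n) (c : R) (up um : 'cV[R]_n) (Qp Qm : 'M[R]_n)
    (f : 'cV[R]_n -> 'cV[R]_n) (gamma : R -> 'cV[R]_n)
    (w fp fm : 'cV[R]_n) (lambda : R[i])
    (nn_unit : dot nn nn = 1)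
    (up_in : half_plus nn c up)
    (um_in : half_minus nn c um)
    (Qp_sym : Qp^T = Qp) (Qp_inv : Qp \in unitmx)
    (Qm_sym : Qm^T = Qm) (Qm_inv : Qm \in unitmx)
    (f_plus : forall u, half_plus nn c u -> f u = Qp *m (u - up))
    (f_minus : forall u, half_minus nn c u -> f u = Qm *m (u - um))
    (gamma_het : heteroclinic (hyperplane nn c) f um up gamma)
    (gamma_plus : forall x : R, 0 < x -> half_plus nn c (gamma x))
    (gamma_minus : forall x : R, x < 0 -> half_minus nn c (gamma x))
    (gamma0 : gamma 0 = w)
    (w_in : hyperplane nn c w)
    (fp_def : fp = Qp *m (w - up))
    (fm_def : fm = Qm *m (w - um))
    (fp_transverse : 0 < dot fp nn)
    (fm_transverse : 0 < dot fm nn)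
    (lambda_neq0 : lambda != 0)
    (lambda_Re : 0 <= complex.Re lambda) :
  spectral_eigenvalue Qp Qm (saltation nn fp fm) lambda <->
  Dfun Qp Qm (saltation nn fp fm) lambda = 0.
Proof.
split; first exact: eigenvalue_Dfun0.
exact: Dfun0_eigenvalue.
Qed.
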